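(* Let $\bm{A},\bm{B},\bm{C},\bm{D}\in\mathbb{X}^{m\times n}$, $\bm{q},\bm{r}\in\mathbb{X}^{m}$, $\bm{g},\bm{h}\in\mathbb{X}^{n}$, where $\bm{C}$ is nonzero, and let $$\mu=\rho(\bm{C}\bm{D}^{-})\oplus\bigoplus_{k=1}^{\min(m,n)}\left(\bm{h}^{-}(\bm{D}^{-}\bm{C})^{k}\bm{g}\oplus(\bm{h}^{-}\bm{D}^{-}\oplus\bm{r}^{-})(\bm{C}\bm{D}^{-})^{k}\bm{q}\right)^{1/k}\oplus\bigoplus_{k=0}^{\min(m,n)}(\bm{r}^{-}\bm{C}(\bm{D}^{-}\bm{C})^{k}\bm{g})^{1/(k+1)},$$ with $\mu>\mathbb{0}$. Consider the problem $$\min_{\bm{x},\bm{y}\ \text{regular}}\ \bm{y}^{-}\bm{A}\bm{x}\quad\text{s.t.}\quad \bm{B}^{-}\bm{y}\leq\bm{x},\quad \mu^{-1}\bm{C}\bm{x}\oplus\bm{q}\leq\bm{y}\leq\bm{r},\quad \bm{D}^{-}\bm{y}\oplus\bm{g}\leq\bm{x}\leq\bm{h},\qquad (\ast)$$ over regular vectors $\bm{x}\in\mathbb{X}^{n}$, $\bm{y}\in\mathbb{X}^{m}$. Put $$\bm{D}_{1}^{-}=\bm{B}^{-}\oplus\bm{D}^{-},\quad \bm{C}_{1}=\mu^{-1}\bm{C},\quad \bm{P}=\bm{A}\bm{D}_{1}^{-},\quad \bm{Q}=\bm{C}_{1}\bm{D}_{1}^{-},\quad \bm{R}=\bm{D}_{1}^{-}\bm{A},\quad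 \bm{S}=\bm{D}_{1}^{-}\bm{C}_{1}.$$ Suppose that $\bm{h}$ and $\bm{r}$ are regular vectors and $\bm{A}$ is a nonzero matrix. Then problem $(\ast)$ is feasible if and only if $$\mathrm{Tr}(\bm{Q})\oplus(\bm{h}^{-}\bm{D}_{1}^{-}\oplus\bm{r}^{-})\bm{Q}^{\ast}\bm{q}\oplus(\bm{r}^{-}\bm{C}_{1}\oplus\bm{h}^{-})\bm{S}^{\ast}\bm{g}\leq\mathbb{1}.$$ In this case, the optimal value of $(\ast)$ is greater than $\mathbb{0}$ and equal to $$\begin{aligned}\eta={}&\bigoplus_{k=1}^{\min(m,n)}\ \bigoplus_{0\leq i_{0}+i_{1}+\cdots+i_{k}\leq\min(m,n)-k}\mathrm{tr}^{1/k}(\bm{Q}^{i_{0}}(\bm{P}\bm{Q}^{i_{1}}\cdots\bm{P}\bm{Q}^{i_{k}}))\\ &\oplus\bigoplus_{k=1}^{\min(m,n)}\ \bigoplus_{0\leq i_{0}+i_{1}+\cdots+i_{k}\leq\min(m,n)-k}((\bm{r}^{-}\bm{C}_{1}\oplus\bm{h}^{-})\bm{S}^{i_{0}}(\bm{R}\bm{S}^{i_{1}}\cdots\bm{R}\bm{S}^{i_{k}})\bm{g})^{1/k}\\ &\oplus\bigoplus_{k=1}^{\min(m,n)}\ \bigoplus_{0\leq i_{0}+i_{1}+\cdots+i_{k}\leq\min(m,n)-k}((\bm{h}^{-}\bm{D}_{1}^{-}\oplus\bm{r}^{-})\bm{Q}^{i_{0}}(\bm{P}\bm{Q}^{i_{1}}\cdots\bm{P}\bm{Q}^{i_{k}})\bm{q})^{1/k}\\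 &\oplus\bigoplus_{k=0}^{\min(m,n)}\ \bigoplus_{0\leq i_{0}+i_{1}+\cdots+i_{k}\leq\min(m,n)-k}(\bm{r}^{-}\bm{A}\bm{S}^{i_{0}}(\bm{R}\bm{S}^{i_{1}}\cdots\bm{R}\bm{S}^{i_{k}})\bm{g})^{1/(k+1)}.\end{aligned}$$ All regular solutions (optimal pairs $(\bm{x},\bm{y})$) of the problem are given by $$\bm{x}=(\eta^{-1}\bm{R}\oplus\bm{S})^{\ast}(\bm{u}\oplus\bm{D}_{1}^{-}\bm{v}),\qquad \bm{y}=(\eta^{-1}\bm{P}\oplus\bm{Q})^{\ast}((\eta^{-1}\bm{A}\oplus\bm{C}_{1})\bm{u}\oplus\bm{v}),$$ where $\bm{u}\in\mathbb{X}^{n}$ and $\bm{v}\in\mathbb{X}^{m}$ are any regular vectors that satisfy the conditions $$\bm{g}\leq\bm{u}\leq((\bm{h}^{-}\oplus\bm{r}^{-}(\eta^{-1}\bm{A}\oplus\bm{C}_{1}))(\eta^{-1}\bm{R}\oplus\bm{S})^{\ast})^{-},\qquad \bm{q}\leq\bm{v}\leq((\bm{h}^{-}\bm{D}_{1}^{-}\oplus\bm{r}^{-})(\eta^{-1}\bm{P}\oplus\bm{Q})^{\ast})^{-}.$$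
   Context: $(\mathbb{X},\oplus,\otimes,\mathbb{0},\mathbb{1})$ is an idempotent semifield: $\oplus$ is associative, commutative and idempotent with neutral element $\mathbb{0}$; $\otimes$ (sign usually omitted) is associative, commutative, distributes over $\oplus$, has unit $\mathbb{1}$, $\mathbb{0}$ is absorbing, and every $a\neq\mathbb{0}$ has an inverse $a^{-1}$. It is linearly ordered by $a\leq b\iff a\oplus b=b$, and algebraically closed: $x^{k}=a$ is solvable for every $a\in\mathbb{X}$ and positive integer $k$; the solution is denoted $a^{1/k}$. The main example is the max-plus semifield $\mathbb{R}\cup\{-\infty\}$ with $\oplus=\max$, $\otimes=+$, $\mathbb{0}=-\infty$, $\mathbb{1}=0$. Matrix addition, multiplication, scalar multiplication and powers over $\mathbb{X}$ are defined in the usual way with $\oplus,\otimes$; $\bm{M}^{0}=\bm{I}$ has $\mathbb{1}$ on the diagonal and $\mathbb{0}$ elsewhere; inequalities between matrices or vectors are entrywise. Vectors are column vectors. A matrix or vector is zero if all its entries are $\mathbb{0}$; a vector is regular if it has no entry equal to $\mathbb{0}$. For a nonzero matrix (or row or column vector) $\bm{M}=(m_{ij})$, the conjugate $\bm{M}^{-}$ is the transposed-size matrix with $(\bm{M}^{-})_{ij}=m_{ji}^{-1}$ if $m_{ji}\neq\mathbb{0}$ and $\mathbb{0}$ otherwise. ($\bm{D}_1^-$ is just the name of the matrix $\bm{B}^-\oplus\bm{D}^-$.) For a square matrix $\bm{M}$ of order $N$: $\mathrm{tr}\,\bm{M}=\bigoplus_{i}m_{ii}$; $\mathrm{tr}^{1/k}(\bm{M})=(\mathrm{tr}\,\bm{M})^{1/k}$;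 $\mathrm{Tr}(\bm{M})=\bigoplus_{k=1}^{N}\mathrm{tr}\,\bm{M}^{k}$; $\rho(\bm{M})=\bigoplus_{k=1}^{N}\mathrm{tr}^{1/k}(\bm{M}^{k})$; the Kleene star is $\bm{M}^{\ast}=\bigoplus_{k=0}^{\infty}\bm{M}^{k}$, which converges iff $\mathrm{Tr}(\bm{M})\leq\mathbb{1}$, in which case $\bm{M}^{\ast}=\bigoplus_{k=0}^{N-1}\bm{M}^{k}$. A condition of the form $\mathrm{Tr}(\bm{Q})\oplus\cdots\leq\mathbb{1}$ is regarded as failing whenever $\mathrm{Tr}(\bm{Q})>\mathbb{1}$. In sums over $i_0,\ldots,i_k$ the indices are nonnegative integers; for $k=0$ the product $\bm{S}^{i_{0}}(\bm{R}\bm{S}^{i_{1}}\cdots\bm{R}\bm{S}^{i_{k}})$ is $\bm{S}^{i_0}$. A problem is feasible if there are regular vectors satisfying its constraints.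
   Formalization: As stated the claim fails when η = 𝟘 (infimum 𝟘 may be unattained, η⁻¹ undefined); the value and solution formulas are proved assuming η > 𝟘, or that the minimum is attained and the semifield is not {𝟘,𝟙}. The feasibility criterion is unconditional. *)

(* Defs.v *)
From HB Require Import structures.
From mathcomp Require Import all_boot all_order all_algebra.
From Stdlib Require Import ClassicalEpsilon.

Set Implicit Arguments.
Unset Strict Implicit.
Unset Printing Implicit Defensive.

Import Order.TTheory GRing.Theory.
Local Open Scope ring_scope.

(* Linearly ordered, algebraically closed idempotent semifields, in semiring
   notation: tropical addition, multiplication, zero and unit are +, *, 0, 1
   (so \sum is an iterated tropical sum, and ^+ and *m are tropical powers and
   products).  Axiom [taddx_total] is totality of the order x <= y iff x + y = y
   declared below.  Roots are a function because, the order being total,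
   x ^+ k = a has at most one solution for k > 0.  [tinv 0] and [troot 0 a] are
   unconstrained. *)
HB.mixin Record isTropSemifield X of GRing.ComNzSemiRing X := {
  tinv : X -> X;
  troot : nat -> X -> X;
  taddxx : forall x : X, x + x = x;
  taddx_total : forall x y : X, (x + y == y) || (y + x == x);
  tmulVx : forall x : X, x != 0 -> tinv x * x = 1;
  trootK : forall (k : nat) (a : X), (0 < k)%N -> troot k a ^+ k = a
}.

#[short(type="tropSemifieldType")]
HB.structure Definition TropSemifield :=
  { X of isTropSemifield X & GRing.ComNzSemiRing X }.

Section TropOrder.

Variable X : tropSemifieldType.

Definition tle (x y : X) : bool := x + y == y.
Definition tlt (x y : X) : bool := (y != x) && tle x y.

Fact tlt_def x y : tlt x y = (y != x) && tle x y.
Proof. by []. Qed.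

Fact tle_refl : reflexive tle.
Proof. by move=> x; rewrite /tle taddxx. Qed.

Fact tle_anti : antisymmetric tle.
Proof. by move=> x y /andP[/eqP xy /eqP yx]; rewrite -yx addrC. Qed.

Fact tle_trans : transitive tle.
Proof.
by move=> y x z /eqP xy /eqP yz; rewrite /tle -yz addrA xy.
Qed.

Fact tle_total : total tle.
Proof. by move=> x y; exact: taddx_total. Qed.

HB.instance Definition _ := Order.isPOrder.Build ring_display
  (TropSemifield.sort X) tlt_def tle_refl tle_anti tle_trans.
HB.instance Definition _ :=
  Order.POrder_isTotal.Build ring_display (TropSemifield.sort X) tle_total.

Lemma tleE (x y : X) : (x <= y) = (x + y == y).
Proof. by []. Qed.

End TropOrder.

Section Matrices.

Variable X : tropSemifieldType.

Definition lemx m n (A B : 'M[X]_(m, n)) : Prop := forall i j, A i j <= B i j.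

Definition regular n (v : 'cV[X]_n) : Prop := forall i, v i ord0 != 0.

(* The conjugate; the same formula sends the zero matrix to zero. *)
Definition tconj m n (A : 'M[X]_(m, n)) : 'M[X]_(n, m) :=
  \matrix_(i, j) (if A j i == 0 then 0 else tinv (A j i)).

Definition scal (A : 'M[X]_1) : X := A ord0 ord0.

Definition Trc N (M : 'M[X]_N) : X := \sum_(1 <= k < N.+1) \tr (M ^+ k).

Definition rho N (M : 'M[X]_N) : X :=
  \sum_(1 <= k < N.+1) troot k (\tr (M ^+ k)).

(* The infinite sum of the powers of M: since partial sums increase, their limit
   is their least upper bound. *)
Definition is_kleene_star N (M K : 'M[X]_N) : Prop :=
  (forall t : nat, lemx (\sum_(0 <= k < t) M ^+ k) K) /\
  (forall L : 'M[X]_N,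
     (forall t : nat, lemx (\sum_(0 <= k < t) M ^+ k) L) -> lemx K L).

(* An arbitrary matrix when the series diverges. *)
Definition kstar N (M : 'M[X]_N) : 'M[X]_N :=
  epsilon (inhabits 0) (is_kleene_star M).

(* S^(i_0) (R S^(i_1)) ... (R S^(i_k)) *)
Definition word N (R S : 'M[X]_N) b k (i : {ffun 'I_k.+1 -> 'I_b}) : 'M[X]_N :=
  S ^+ i ord0 * \prod_(j < k) (R * S ^+ i (lift ord0 j)).

(* The sum of F (word R S i) over all i_0, ..., i_k with
   i_0 + ... + i_k <= b; each index is then at most b. *)
Definition wordsum N (R S : 'M[X]_N) (b k : nat) (F : 'M[X]_N -> X) : X :=
  \sum_(i : {ffun 'I_k.+1 -> 'I_b.+1} | (\sum_(j < k.+1) i j <= b)%N)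
     F (word R S i).

End Matrices.

Notation "A <=mx B" := (lemx A B) (at level 70, no associativity) : ring_scope.
Notation "A ^~mx" := (tconj A) (at level 2, format "A ^~mx") : ring_scope.

Section Problem.

Variables (X : tropSemifieldType) (m n : nat).
Implicit Types (A B C D : 'M[X]_(m, n)) (q r y v : 'cV[X]_m)
  (g h x u : 'cV[X]_n).

Definition mu_value C D q r g h : X :=
  let l := minn m n in
  let CD := C *m D^~mx in
  let DC := D^~mx *m C in
  rho CD
  + \sum_(1 <= k < l.+1)
      troot k (scal (h^~mx *m DC ^+ k *m g)
               + scal ((h^~mx *m D^~mx + r^~mx) *m CD ^+ k *m q))
  + \sum_(0 <= k < l.+1) troot k.+1 (scal (r^~mx *m C *m DC ^+ k *m g)).

(* D1 stands for the n x m matrix whose usual name is D_1^-. *)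
Definition eta_value A C1 (D1 : 'M[X]_(n, m)) q r g h : X :=
  let l := minn m n in
  let P := A *m D1 in
  let Q := C1 *m D1 in
  let R := D1 *m A in
  let S := D1 *m C1 in
  \sum_(1 <= k < l.+1) wordsum P Q (l - k) k (fun W => troot k (\tr W))
  + \sum_(1 <= k < l.+1) wordsum R S (l - k) k (fun W =>
      troot k (scal ((r^~mx *m C1 + h^~mx) *m W *m g)))
  + \sum_(1 <= k < l.+1) wordsum P Q (l - k) k (fun W =>
      troot k (scal ((h^~mx *m D1 + r^~mx) *m W *m q)))
  + \sum_(0 <= k < l.+1) wordsum R S (l - k) k (fun W =>
      troot k.+1 (scal (r^~mx *m A *m W *m g))).

Definition objective A x y : X := scal (y^~mx *m A *m x).

Definition feasible B C D q r g h (mu : X) x y : Prop :=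
  [/\ regular x, regular y,
      B^~mx *m y <=mx x,
      tinv mu *: C *m x + q <=mx y /\ y <=mx r &
      D^~mx *m y + g <=mx x /\ x <=mx h].

Definition optimal A B C D q r g h (mu : X) x y : Prop :=
  feasible B C D q r g h mu x y /\
  forall x' y', feasible B C D q r g h mu x' y' ->
    objective A x y <= objective A x' y'.

Definition optimal_value A B C D q r g h (mu th : X) : Prop :=
  exists x y, optimal A B C D q r g h mu x y /\ objective A x y = th.

End Problem.

(* Main.v *)
Require Import Defs.
From HB Require Import structures.
From mathcomp Require Import all_boot all_order all_algebra.
From mathcomp Require Import zify.
From Stdlib Require Import ClassicalEpsilon.

Set Implicit Arguments.
Unset Strict Implicit.
Unset Printing Implicit Defensive.

Import Order.TTheory GRing.Theory.
Local Open Scope ring_scope.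

(** Write [D1] for the matrix with [D1 y <= x] iff both [B^- y <= x] and
    [D^- y <= x]. Feasibility is then a pair of coupled inequalities
    [C1 x + q <= y <= r], [D1 y + g <= x <= h]. For regular [y] and nonzero [th],
    the inequality [y^- A x <= th] is the same as [th^-1 A x <= y], so the
    feasible pairs of value at most [th] solve the coupled system in which
    [C1] is replaced by [th^-1 A + C1] ([coupled_objectiveP]). One theory of
    coupled systems hence settles feasibility, the optimal value and the set of
    solutions.

    A coupled system with matrices [C] and [D] makes [x] and [y] subfixed points
    of [D C] and [C D]. A regular subfixed point exists only if no closed walk
    has weight above 1; then the star is a finite sum of powers
    ([power_le_partial_star]), every solution is a fixed point of it, and
    residuation turns the bounds [r] and [h] into upper bounds for the parameters
    ([coupled_solutionP]). Nonemptiness of the parameter intervals is the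
    solvability criterion ([coupled_solvableP]).

    It remains to solve this criterion for [th]. Since walks alternate between
    rows and columns, powers up to [minn m n] suffice ([coupled_solvable_min]).
    A power of [th^-1 P + Q] is the sum of all words in [P] and [Q] of that
    length, each scaled by [th^-k] where [k] counts the letters [P]; the
    bound on the word reads [w <= th^k], that is, [th] is at least the [k]-th root
    of [w]. All these roots together form [eta], so for nonzero [th] the criterion
    says [eta <= th] ([eta_leP]).

    Values at feasible pairs are nonzero, hence at least [eta], and a nonzero
    [eta] is attained. If [eta] were zero, every nonzero value could be undercut
    by a factor below 1; so an optimum, together with a scalar other than 0
    and 1, forces [eta] to be nonzero. *)

(** * The order of an idempotent semifield *)

Section Scalars.

Variable X : tropSemifieldType.
Implicit Types a b c x y : X.

Lemma tle0x x : (0 : X) <= x.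
Proof. by rewrite tleE add0r. Qed.

Lemma tlt0x x : ((0 : X) < x) = (x != 0).
Proof. by rewrite lt_def tle0x andbT. Qed.

Lemma tleD_lub x y c : (x + y <= c) = (x <= c) && (y <= c).
Proof.
have ub a b : a <= a + b by rewrite tleE addrA taddxx.
apply/idP/andP => [xyc|[xc yc]].
  by split; apply: le_trans xyc; rewrite // addrC.
by rewrite tleE -addrA (eqP yc).
Qed.

Lemma tle_sumP (I : Type) (s : seq I) (P : pred I) (F : I -> X) c :
  (\sum_(i <- s | P i) F i <= c) = all (fun i => P i ==> (F i <= c)) s.
Proof.
elim: s => [|i s IH] /=; first by rewrite big_nil tle0x.
by rewrite big_cons; case: (P i) => //=; rewrite tleD_lub IH.
Qed.

Lemma tle_bigsumP (I : finType) (P : pred I) (F : I -> X) c :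
  reflect (forall i, P i -> F i <= c) (\sum_(i | P i) F i <= c).
Proof.
rewrite tle_sumP; apply: (iffP allP) => [H i Pi | H i _].
  by apply: (implyP (H i (mem_index_enum i))).
by apply/implyP/H.
Qed.

Lemma tle_natsumP (lo hi : nat) (F : nat -> X) c :
  reflect (forall k, (lo <= k < hi)%N -> F k <= c)
          (\sum_(lo <= k < hi) F k <= c).
Proof.
rewrite tle_sumP; apply: (iffP allP) => H k.
  by rewrite -mem_index_iota => /H.
by rewrite mem_index_iota => /H.
Qed.

Lemma tle_sumr (I : finType) (P : pred I) (F : I -> X) i :
  P i -> F i <= \sum_(j | P j) F j.
Proof. by apply: (@tle_bigsumP I P F). Qed.

Lemma tle_mul2l a x y : x <= y -> a * x <= a * y.
Proof. by rewrite !tleE -mulrDr => /eqP ->. Qed.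

Lemma tle_mul2r a x y : x <= y -> x * a <= y * a.
Proof. by move=> xy; rewrite ![_ * a]mulrC tle_mul2l. Qed.

Lemma tle_mul x y x' y' : x <= x' -> y <= y' -> x * y <= x' * y'.
Proof. by move=> /(tle_mul2r y) H /(tle_mul2l x'); apply: le_trans. Qed.

Lemma tmulxV x : x != 0 -> x * tinv x = 1.
Proof. by rewrite mulrC; apply: tmulVx. Qed.

Lemma tinv_neq0 x : x != 0 -> tinv x != 0.
Proof.
by move=> x0; apply/eqP => V0; have := tmulVx _ x0; rewrite V0 mul0r => /esym/eqP;
  rewrite oner_eq0.
Qed.

Lemma tmul_neq0 x y : x != 0 -> y != 0 -> x * y != 0.
Proof.
move=> x0 y0; apply/eqP => xy0; move/negP: y0; apply.
by rewrite -[y]mul1r -(tmulVx _ x0) -mulrA xy0 mulr0.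
Qed.

Lemma tle_neq0 x y : x <= y -> x != 0 -> y != 0.
Proof. by rewrite -!tlt0x => xy x0; apply: lt_le_trans xy. Qed.

Lemma texp_neq0 x k : x != 0 -> x ^+ k != 0.
Proof.
by move=> x0; elim: k => [|k IH]; rewrite ?expr0 ?oner_eq0 // exprS tmul_neq0.
Qed.

Lemma tle_pmul2l a x y : a != 0 -> (a * x <= a * y) = (x <= y).
Proof.
move=> a0; apply/idP/idP => [/(tle_mul2l (tinv a))|]; last exact: tle_mul2l.
by rewrite !mulrA tmulVx // !mul1r.
Qed.

Lemma tle_divl a x y : a != 0 -> (tinv a * x <= y) = (x <= a * y).
Proof. by move=> a0; rewrite -(tle_pmul2l _ _ a0) mulrA tmulxV ?mul1r. Qed.

Lemma tinvK x : x != 0 -> tinv (tinv x) = x.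
Proof.
move=> x0; rewrite -[LHS]mulr1 -(tmulVx _ x0) mulrA tmulVx ?mul1r //.
exact: tinv_neq0.
Qed.

Lemma tle_exp x y k : x <= y -> x ^+ k <= y ^+ k.
Proof.
by move=> xy; elim: k => [|k IH]; rewrite ?expr0 // !exprS tle_mul.
Qed.

(** Strictness is not preserved by multiplication in general, as 0 absorbs; here
    the larger of the two bases is invertible. *)
Lemma tle_exp2 x y k : (0 < k)%N -> (x ^+ k <= y ^+ k) = (x <= y).
Proof.
case: k => // k _; apply/idP/idP; last exact: tle_exp.
move=> xy; rewrite leNgt; apply/negP => yx.
have x0 : x != 0 by rewrite -tlt0x; apply: le_lt_trans yx; apply: tle0x.
(* x^(k+1) <= y^(k+1) <= x^k y, and x^k cancels *)
suff: x <= y by rewrite leNgt yx.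
rewrite -(tle_pmul2l _ _ (texp_neq0 k x0)) -exprSr; apply: le_trans xy _.
by rewrite exprSr; apply/tle_mul2r/tle_exp/ltW.
Qed.

Lemma troot_leP k a c : (0 < k)%N -> (troot k a <= c) = (a <= c ^+ k).
Proof. by move=> k0; rewrite -(tle_exp2 _ _ k0) trootK. Qed.

Lemma tle_div_exp t k a c : t != 0 ->
  (tinv t ^+ k * a <= c) = (a <= c * t ^+ k).
Proof.
move=> t0; rewrite -(tle_pmul2l _ _ (texp_neq0 k t0)) mulrA -exprMn.
by rewrite tmulxV // expr1n mul1r mulrC.
Qed.

End Scalars.

(** * The entrywise order of matrices and residuation *)

Section MatrixOrder.

Variable X : tropSemifieldType.

Lemma lemxE m n (A B : 'M[X]_(m, n)) : A <=mx B <-> A + B = B.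
Proof.
split=> [AB | AB i j]; first by apply/matrixP => i j; rewrite mxE; apply/eqP/AB.
by rewrite tleE -[in X in _ == X]AB mxE.
Qed.

Lemma lemx_refl m n (A : 'M[X]_(m, n)) : A <=mx A.
Proof. by move=> i j. Qed.
Hint Resolve lemx_refl : core.

Lemma lemx_trans m n (B A C : 'M[X]_(m, n)) : A <=mx B -> B <=mx C -> A <=mx C.
Proof. by move=> AB BC i j; apply: le_trans (AB i j) (BC i j). Qed.

Lemma lemx_anti m n (A B : 'M[X]_(m, n)) : A <=mx B -> B <=mx A -> A = B.
Proof. by move=> AB BA; apply/matrixP => i j; apply/le_anti; rewrite AB BA. Qed.

Lemma lemxD_lub m n (A B C : 'M[X]_(m, n)) :
  A + B <=mx C <-> A <=mx C /\ B <=mx C.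
Proof.
split=> [H | [AC BC] i j].
  by split=> i j; have := H i j; rewrite mxE tleD_lub => /andP[].
by rewrite mxE tleD_lub AC BC.
Qed.

Lemma lemxDl m n (A B : 'M[X]_(m, n)) : A <=mx A + B.
Proof. by have /lemxD_lub[] := lemx_refl (A + B). Qed.

Lemma lemxDr m n (A B : 'M[X]_(m, n)) : B <=mx A + B.
Proof. by have /lemxD_lub[] := lemx_refl (A + B). Qed.

Lemma lemx_sumP m n a b (F : nat -> 'M[X]_(m, n)) (C : 'M[X]_(m, n)) :
  \sum_(a <= k < b) F k <=mx C <-> forall k, (a <= k < b)%N -> F k <=mx C.
Proof.
split=> [H k kab i j | H i j].
  by have := H i j; rewrite summxE => /tle_natsumP; apply.
by rewrite summxE; apply/tle_natsumP => k /H.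
Qed.

Lemma lemx_sumr m n a b (F : nat -> 'M[X]_(m, n)) k :
  (a <= k < b)%N -> F k <=mx \sum_(a <= k < b) F k.
Proof. by move: k; apply/lemx_sumP. Qed.

Lemma lemx_mul2l m n p (A : 'M[X]_(m, n)) (B B' : 'M[X]_(n, p)) :
  B <=mx B' -> A *m B <=mx A *m B'.
Proof. by rewrite !lemxE -mulmxDr => ->. Qed.

Lemma lemx_mul2r m n p (A A' : 'M[X]_(m, n)) (B : 'M[X]_(n, p)) :
  A <=mx A' -> A *m B <=mx A' *m B.
Proof. by rewrite !lemxE -mulmxDl => ->. Qed.

Lemma lemx_mul m n p (A A' : 'M[X]_(m, n)) (B B' : 'M[X]_(n, p)) :
  A <=mx A' -> B <=mx B' -> A *m B <=mx A' *m B'.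
Proof.
by move=> /(lemx_mul2r B) H /(lemx_mul2l A'); apply: lemx_trans.
Qed.

Lemma lemx_exp N (A B : 'M[X]_N) k : A <=mx B -> A ^+ k <=mx B ^+ k.
Proof.
by move=> AB; elim: k => [|k IH]; rewrite ?expr0 // !exprS; apply: lemx_mul.
Qed.

Lemma lemx_scal (A B : 'M[X]_1) : A <=mx B -> scal A <= scal B.
Proof. exact. Qed.

Lemma lemx_regular n (x y : 'cV[X]_n) : x <=mx y -> regular x -> regular y.
Proof. by move=> xy x_reg i; apply: tle_neq0 (x_reg i). Qed.

Lemma scalD (A B : 'M[X]_1) : scal (A + B) = scal A + scal B.
Proof. by rewrite /scal mxE. Qed.

Lemma scalZ c (A : 'M[X]_1) : scal (c *: A) = c * scal A.
Proof. by rewrite /scal mxE. Qed.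

Lemma tconjE m n (A : 'M[X]_(m, n)) i j :
  A i j != 0 -> A^~mx j i = tinv (A i j).
Proof. by rewrite mxE => /negbTE ->. Qed.

Lemma tconjK n (y : 'cV[X]_n) : regular y -> y^~mx^~mx = y.
Proof.
move=> y_reg; apply/matrixP => i j; rewrite (ord1 j).
by rewrite tconjE !tconjE ?tinv_neq0 // tinvK.
Qed.

Lemma tconj_neq0 m n (A : 'M[X]_(m, n)) i j : A i j != 0 -> A^~mx j i != 0.
Proof. by move=> Aij; rewrite tconjE // tinv_neq0. Qed.

(** Multiplying by a row without zero entries is residuated, and the conjugate
    of the row computes the residual. *)
Lemma row_mul_leP n (w : 'rV[X]_n) (z : 'cV[X]_n) :
  (forall j, w ord0 j != 0) -> scal (w *m z) <= 1 <-> z <=mx w^~mx.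
Proof.
move=> w_reg; rewrite /scal mxE; split=> [/tle_bigsumP H j k | H].
  rewrite (ord1 k) tconjE // -(tle_pmul2l _ _ (w_reg j)) tmulxV //.
  exact: H.
apply/tle_bigsumP => j _; have := H j ord0.
by rewrite tconjE // -(tle_pmul2l _ _ (w_reg j)) tmulxV.
Qed.

Lemma conj_mul_leP n (y z : 'cV[X]_n) :
  regular y -> scal (y^~mx *m z) <= 1 <-> z <=mx y.
Proof.
move=> y_reg; rewrite row_mul_leP ?tconjK // => j.
exact: tconj_neq0.
Qed.

(** The objective is eliminated here: bounding it amounts to one more linear
    inequality of the same shape as the constraint on [C]. *)
Lemma objective_leP m n (A : 'M[X]_(m, n)) x y th : regular y -> th != 0 ->
  objective A x y <= th <-> (tinv th *: A) *m x <=mx y.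
Proof.
move=> y_reg th0; rewrite -conj_mul_leP // -scalemxAl -scalemxAr scalZ.
by rewrite tle_divl // mulr1 mulmxA.
Qed.

Lemma objective_neq0 m n (A : 'M[X]_(m, n)) x y :
  A != 0 -> regular x -> regular y -> objective A x y != 0.
Proof.
move=> A0 x_reg y_reg.
have /existsP[i /existsP[j Aij]] : [exists i, exists j, A i j != 0].
  apply: contraNT A0 => /existsPn H; apply/eqP/matrixP => i j; rewrite mxE.
  by apply/eqP; have /existsPn/(_ j) := H i; rewrite negbK.
rewrite /objective /scal -mulmxA mxE.
apply: (tle_neq0 (tle_sumr _ (isT : xpredT i))).
apply: tmul_neq0; first exact: tconj_neq0.
rewrite mxE; apply: (tle_neq0 (tle_sumr _ (isT : xpredT j))).
exact: tmul_neq0.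
Qed.

End MatrixOrder.

#[local] Hint Resolve lemx_refl : core.

(** * Closed walks and the Kleene star *)

Section Star.

Variable X : tropSemifieldType.

(** The entries of [M ^+ k] are the sums of these weights over the walks with [k]
    steps; the list holds the vertices after the first one. *)
Fixpoint walk_weight N (M : 'M[X]_N) (i : 'I_N) (s : seq 'I_N) : X :=
  if s is j :: s' then M i j * walk_weight M j s' else 1.

Lemma walk_weight_cat N (M : 'M[X]_N) i s1 s2 :
  walk_weight M i (s1 ++ s2) = walk_weight M i s1 * walk_weight M (last i s1) s2.
Proof. by elim: s1 i => [|j s1 IH] i /=; rewrite ?mul1r // IH mulrA. Qed.

Lemma walk_weight_detour N (M : 'M[X]_N) i s1 v s2 s3 :
  walk_weight M i (s1 ++ v :: s2 ++ v :: s3) =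
  walk_weight M v (rcons s2 v) * walk_weight M i (s1 ++ v :: s3).
Proof.
rewrite -(cat_rcons v s2) !walk_weight_cat /= walk_weight_cat last_rcons.
by rewrite [M _ v * _]mulrCA [LHS]mulrCA.
Qed.

Lemma walk_weight_le N (M : 'M[X]_N) i s :
  walk_weight M i s <= (M ^+ size s) i (last i s).
Proof.
elim: s i => [|j s IH] i /=; first by rewrite expr0 mxE eqxx.
rewrite exprS mxE; apply: le_trans (tle_sumr _ (isT : xpredT j)).
exact: tle_mul2l.
Qed.

(** The factor [a] is what lets the induction on [k] move the first step of the
    walk out of the power. *)
Lemma power_entry_le N (M : 'M[X]_N) k a c i j :
  (forall s, size s = k -> last i s = j -> a * walk_weight M i s <= c) ->
  a * (M ^+ k) i j <= c.
Proof.
elim: k a i => [|k IH] a i H.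
  rewrite expr0 mxE; case: eqP => [ij | _]; last by rewrite mulr0 tle0x.
  exact: (H [::]).
rewrite exprS mxE mulr_sumr; apply/tle_bigsumP => l _; rewrite mulrA.
apply: IH => s sk sj; rewrite -mulrA.
by apply: (H (l :: s)); rewrite /= ?sk.
Qed.

Lemma not_uniq_split (T : eqType) (s : seq T) : ~~ uniq s ->
  exists s1 v s2 s3, s = s1 ++ v :: s2 ++ v :: s3.
Proof.
elim: s => //= x s IH; rewrite negb_and negbK.
case/orP => [|/IH[s1 [v [s2 [s3 ->]]]]].
  by case/splitPr => s1 s2; exists [::], x, s1, s2.
by exists (x :: s1), v, s2, s3.
Qed.

Lemma long_seq_split N (s : seq 'I_N) : (N < size s)%N ->
  exists s1 v s2 s3, s = s1 ++ v :: s2 ++ v :: s3.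
Proof.
move=> Ns; apply: not_uniq_split; apply: contraTN Ns => /card_uniqP <-.
by rewrite -leqNgt -[N in (_ <= N)%N]card_ord max_card.
Qed.

(** The trace of [M ^+ k] is the largest weight of a closed walk with [k] steps,
    so this is the condition under which going around a circuit gains nothing. *)
Definition circuits_le1 N (M : 'M[X]_N) : Prop :=
  forall k, (0 < k)%N -> \tr (M ^+ k) <= 1.

Lemma closed_walk_le1 N (M : 'M[X]_N) i s : (0 < size s)%N ->
  \tr (M ^+ size s) <= 1 -> last i s = i -> walk_weight M i s <= 1.
Proof.
move=> s0 /tle_bigsumP H si; apply: le_trans (walk_weight_le M i s) _.
by rewrite si; apply: H.
Qed.

(** A closed walk with more than [N] steps meets some vertex twice, hence is the
    product of two shorter closed walks. *)
Lemma circuits_le1_short N (M : 'M[X]_N) :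
  (forall k, (0 < k <= N)%N -> \tr (M ^+ k) <= 1) -> circuits_le1 M.
Proof.
move=> H; elim/ltn_ind => k IH k0.
have [kN|Nk] := leqP k N; first by apply: H; rewrite k0.
apply/tle_bigsumP => i _; rewrite -[X in X <= _]mul1r.
apply: power_entry_le => s sk si; rewrite mul1r.
have [s1 [v [s2 [s3 def_s]]]] : exists s1 v s2 s3, s = s1 ++ v :: s2 ++ v :: s3.
  by apply: long_seq_split; rewrite sk.
have walk_le1 t j : (0 < size t < k)%N -> last j t = j ->
    walk_weight M j t <= 1.
  move=> /andP[t0 tk]; apply: closed_walk_le1 => //; exact: IH.
have size_s := sk; rewrite def_s size_cat /= size_cat /= in size_s.
rewrite def_s walk_weight_detour.
rewrite -[1 in X in _ <= X]mul1r; apply: tle_mul; apply: walk_le1.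
- rewrite size_rcons /= -size_s; lia.
- by rewrite last_rcons.
- rewrite size_cat /= -size_s; lia.
- by rewrite last_cat /= -[RHS]si def_s last_cat /= last_cat.
Qed.

(** Deleting closed subwalks does not decrease the weight and leaves a walk
    that visits each vertex at most once, hence has fewer than [N] steps. *)
Lemma power_le_partial_star N (M : 'M[X]_N) k : circuits_le1 M ->
  M ^+ k <=mx \sum_(0 <= t < N) M ^+ t.
Proof.
move=> M_le1; pose T := \sum_(0 <= t < N) M ^+ t.
suff walk_le s i : walk_weight M i s <= T i (last i s).
  move=> i j; rewrite -[X in X <= _]mul1r; apply: power_entry_le => s _ <-.
  by rewrite mul1r; apply: walk_le.
have [l ls] := ubnP (size s); elim: l => // l IH in s i ls *.
have [sN|Ns] := ltnP (size s) N.
  by apply: le_trans (walk_weight_le M i s) _; apply: lemx_sumr.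
have drop_circuit v s2 : walk_weight M v (rcons s2 v) <= 1.
  apply: closed_walk_le1; rewrite ?size_rcons ?last_rcons //.
  exact: M_le1.
have [s1 [v [s2 [s3]]]] := @long_seq_split N (i :: s) Ns.
case: s1 => [|_x s1] /= [] => [<-|_] def_s; move: ls; rewrite def_s.
  rewrite -cat_rcons walk_weight_cat last_cat last_rcons size_cat => ls.
  apply: le_trans (IH s3 i _); last by move: ls; rewrite size_rcons; lia.
  by rewrite -[X in _ <= X]mul1r; apply/tle_mul2r.
rewrite walk_weight_detour => ls.
have -> u : last u (s1 ++ v :: s2 ++ v :: s3) = last u (s1 ++ v :: s3).
  by rewrite !last_cat /= last_cat.
apply: le_trans (IH (s1 ++ v :: s3) _ _); last first.
  by move: ls; rewrite !size_cat /= size_cat /=; lia.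
by rewrite -[X in _ <= X]mul1r; apply/tle_mul2r.
Qed.

Lemma kstarE N (M : 'M[X]_N) : circuits_le1 M ->
  kstar M = \sum_(0 <= k < N) M ^+ k.
Proof.
move=> M_le1; pose T := \sum_(0 <= t < N) M ^+ t.
have T_star : is_kleene_star M T.
  by split=> [t | L]; [apply/lemx_sumP => k _; apply: power_le_partial_star | apply].
have [ubK lubK] : is_kleene_star M (kstar M).
  by apply: epsilon_spec; exists T.
apply: lemx_anti; last exact: ubK.
by apply: lubK => t; have [ubT _] := T_star; apply: ubT.
Qed.

(** The star acts as the supremum of all powers even inside products, because
    finitely many powers already give it. *)
Lemma mul_kstar_leP N p p' (M : 'M[X]_N) (A : 'M[X]_(p, N)) (B : 'M[X]_(N, p'))
    (Z : 'M[X]_(p, p')) : circuits_le1 M ->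
  A *m kstar M *m B <=mx Z <-> forall k, A *m M ^+ k *m B <=mx Z.
Proof.
move=> M_le1; rewrite kstarE //; split=> [H k | H].
  apply: lemx_trans H; apply/lemx_mul2r/lemx_mul2l.
  exact: power_le_partial_star.
rewrite mulmx_sumr mulmx_suml; apply/lemx_sumP => k _; exact: H.
Qed.

Lemma power_le_kstar N (M : 'M[X]_N) k : circuits_le1 M -> M ^+ k <=mx kstar M.
Proof. by move=> M_le1; rewrite kstarE //; apply: power_le_partial_star. Qed.

Lemma id_le_kstar N (M : 'M[X]_N) : circuits_le1 M -> 1%:M <=mx kstar M.
Proof. exact: (@power_le_kstar _ _ 0). Qed.

Lemma row_kstar_leP N (M : 'M[X]_N) (a : 'rV[X]_N) (b : 'cV[X]_N) c :
  circuits_le1 M ->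
  scal (a *m kstar M *m b) <= c <-> forall k, scal (a *m M ^+ k *m b) <= c.
Proof.
have to_mx (Z : 'M[X]_1) : scal Z <= c <-> Z <=mx c%:M.
  split=> [Zc i j | /(_ ord0 ord0)]; last by rewrite mxE eqxx.
  by rewrite !ord1 mxE eqxx.
move=> M_le1; rewrite to_mx mul_kstar_leP //.
by split=> H k; apply/to_mx.
Qed.

Lemma power_subfixed N (M : 'M[X]_N) (x : 'cV[X]_N) k :
  M *m x <=mx x -> M ^+ k *m x <=mx x.
Proof.
move=> Mx; elim: k => [|k IH]; first by rewrite expr0 mul1mx.
rewrite exprS -mulmxE -mulmxA; apply: lemx_trans Mx; exact: lemx_mul2l.
Qed.

Lemma kstar_fixed N (M : 'M[X]_N) (x : 'cV[X]_N) : circuits_le1 M ->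
  M *m x <=mx x -> kstar M *m x = x.
Proof.
move=> M_le1 Mx; apply: lemx_anti.
  rewrite -[kstar M]mul1mx; apply/mul_kstar_leP => // k; rewrite mul1mx.
  exact: power_subfixed.
by rewrite -[X in X <=mx _]mul1mx; apply/lemx_mul2r/id_le_kstar.
Qed.

(** A closed walk at [i] of weight [w] gives [w * x i <= x i], and [x i]
    cancels. *)
Lemma circuits_le1_subfixed N (M : 'M[X]_N) (x : 'cV[X]_N) :
  regular x -> M *m x <=mx x -> circuits_le1 M.
Proof.
move=> x_reg Mx k _; apply/tle_bigsumP => i _.
rewrite -(tle_pmul2l _ _ (x_reg i)) mulr1 mulrC.
have := power_subfixed k Mx i ord0; rewrite mxE; apply: le_trans.
exact: (@tle_sumr _ _ _ (fun j => (M ^+ k) i j * x j ord0)).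
Qed.

Lemma Trc_leP N (M : 'M[X]_N) : Trc M <= 1 <-> circuits_le1 M.
Proof.
split=> [/tle_natsumP H | H].
  by apply: circuits_le1_short => k kN; apply: H.
by apply/tle_natsumP => k /andP[k0 _]; apply: H.
Qed.

(** ** Products of two rectangular matrices *)

Lemma expr_mulC m n (C : 'M[X]_(m, n)) (D : 'M[X]_(n, m)) k :
  (D *m C) ^+ k *m D = D *m (C *m D) ^+ k.
Proof.
elim: k => [|k IH]; first by rewrite !expr0 mul1mx mulmx1.
by rewrite !exprSr -!mulmxE mulmxA IH -!mulmxA.
Qed.

Lemma exprS_mul m n (C : 'M[X]_(m, n)) (D : 'M[X]_(n, m)) k :
  (C *m D) ^+ k.+1 = C *m (D *m C) ^+ k *m D.
Proof. by rewrite -mulmxA expr_mulC exprS -mulmxE mulmxA. Qed.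

Lemma mxtrace_exprC m n (C : 'M[X]_(m, n)) (D : 'M[X]_(n, m)) k : (0 < k)%N ->
  \tr ((C *m D) ^+ k) = \tr ((D *m C) ^+ k).
Proof.
by case: k => // k _; rewrite exprS_mul mxtrace_mulC mulmxA exprS -mulmxE.
Qed.

Lemma circuits_le1C m n (C : 'M[X]_(m, n)) (D : 'M[X]_(n, m)) :
  circuits_le1 (C *m D) -> circuits_le1 (D *m C).
Proof. by move=> H k k0; rewrite mxtrace_exprC //; apply: H. Qed.

(** The two products have the same traces of positive powers, so the criterion
    can be tested on the smaller one. *)
Lemma circuits_le1_min m n (C : 'M[X]_(m, n)) (D : 'M[X]_(n, m)) :
  (forall k, (0 < k <= minn m n)%N -> \tr ((C *m D) ^+ k) <= 1) ->
  circuits_le1 (C *m D).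
Proof.
move=> H; have [mn|nm] := leqP m n.
  apply: circuits_le1_short => k /andP[k0 km]; apply: H; lia.
apply/circuits_le1C/circuits_le1_short => k /andP[k0 kn].
by rewrite mxtrace_exprC //; apply: H; lia.
Qed.

(** Walks alternate between the [m] rows and the [n] columns, and the smaller of
    the two sides already limits how long they stay free of repetitions. *)
Lemma power_le_min_star m n (C : 'M[X]_(m, n)) (D : 'M[X]_(n, m)) k :
  circuits_le1 (C *m D) ->
  (C *m D) ^+ k <=mx \sum_(0 <= t < (minn m n).+1) (C *m D) ^+ t.
Proof.
move=> H; have [mn|nm] := leqP m n.
  apply: lemx_trans (power_le_partial_star k H) _.
  by apply/lemx_sumP => t tm; apply: lemx_sumr; lia.
case: k => [|k]; first exact: lemx_sumr.
rewrite exprS_mul.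
apply: (@lemx_trans _ _ _ (C *m (\sum_(0 <= t < n) (D *m C) ^+ t) *m D)).
  by apply/lemx_mul2r/lemx_mul2l/power_le_partial_star/circuits_le1C.
rewrite mulmx_sumr mulmx_suml; apply/lemx_sumP => t tn.
by rewrite -exprS_mul; apply: lemx_sumr; lia.
Qed.

Lemma row_power_le_min m n (C : 'M[X]_(m, n)) (D : 'M[X]_(n, m))
    (a : 'rV[X]_m) (b : 'cV[X]_m) c :
  circuits_le1 (C *m D) ->
  (forall t, (t <= minn m n)%N -> scal (a *m (C *m D) ^+ t *m b) <= c) ->
  forall k, scal (a *m (C *m D) ^+ k *m b) <= c.
Proof.
move=> H short k.
apply: (@le_trans _ _
  (scal (a *m (\sum_(0 <= t < (minn m n).+1) (C *m D) ^+ t) *m b))).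
  by apply/lemx_scal/lemx_mul2r/lemx_mul2l/power_le_min_star.
rewrite mulmx_sumr mulmx_suml /scal summxE; apply/tle_natsumP => t tl.
exact: short.
Qed.

Lemma kstar_mulC m n (C : 'M[X]_(m, n)) (D : 'M[X]_(n, m)) :
  circuits_le1 (C *m D) -> kstar (D *m C) *m D = D *m kstar (C *m D).
Proof.
move=> H; have H' := circuits_le1C H; apply: lemx_anti.
  rewrite -[kstar _]mul1mx; apply/mul_kstar_leP => // k; rewrite mul1mx.
  by rewrite expr_mulC; apply/lemx_mul2l/power_le_kstar.
rewrite -[X in X <=mx _]mulmx1; apply/mul_kstar_leP => // k; rewrite mulmx1.
by rewrite -expr_mulC; apply/lemx_mul2r/power_le_kstar.
Qed.

Lemma kstar_mul_le N (M : 'M[X]_N) (x : 'cV[X]_N) : circuits_le1 M ->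
  kstar M *m (M *m x) <=mx kstar M *m x.
Proof.
move=> M_le1; rewrite -[X in X *m (M *m x)]mul1mx; apply/mul_kstar_leP => // k.
rewrite mul1mx mulmxA mulmxE -exprSr; exact/lemx_mul2r/power_le_kstar.
Qed.

End Star.

(** * Coupled two-sided inequalities *)

Section Coupled.

Variable X : tropSemifieldType.

(** This shape is symmetric: exchanging the two unknowns exchanges [C] with [D]
    and the bounds of one with those of the other, which halves the proofs
    below. *)
Definition coupled m n (C : 'M[X]_(m, n)) (D : 'M[X]_(n, m)) (q r : 'cV[X]_m)
    (g h : 'cV[X]_n) (x : 'cV[X]_n) (y : 'cV[X]_m) : Prop :=
  [/\ regular x, regular y,
      C *m x + q <=mx y /\ y <=mx r & D *m y + g <=mx x /\ x <=mx h].

Definition coupled_solvable m n (C : 'M[X]_(m, n)) (D : 'M[X]_(n, m))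
    (q r : 'cV[X]_m) (g h : 'cV[X]_n) : Prop :=
  [/\ circuits_le1 (C *m D),
      forall k, scal ((h^~mx *m D + r^~mx) *m (C *m D) ^+ k *m q) <= 1 &
      forall k, scal ((r^~mx *m C + h^~mx) *m (D *m C) ^+ k *m g) <= 1].

Lemma coupledC m n (C : 'M[X]_(m, n)) (D : 'M[X]_(n, m)) q r g h x y :
  coupled C D q r g h x y -> coupled D C g h q r y x.
Proof. by case. Qed.

Lemma coupled_solvable_starP m n (C : 'M[X]_(m, n)) (D : 'M[X]_(n, m)) q r g h :
  Trc (C *m D)
    + scal ((h^~mx *m D + r^~mx) *m kstar (C *m D) *m q)
    + scal ((r^~mx *m C + h^~mx) *m kstar (D *m C) *m g) <= 1
  <-> coupled_solvable C D q r g h.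
Proof.
rewrite !tleD_lub; split=> [/andP[/andP[/Trc_leP H1 H2] H3] | [H1 H2 H3]].
  by have H1' := circuits_le1C H1; split=> //; apply/row_kstar_leP.
have H1' := circuits_le1C H1.
by rewrite -!andbA; apply/and3P; split; [apply/Trc_leP | apply/row_kstar_leP ..].
Qed.

Lemma residual_row_leP m n (C : 'M[X]_(m, n)) (r : 'cV[X]_m) (h : 'cV[X]_n)
    (z : 'cV[X]_n) :
  regular r -> regular h ->
  scal ((r^~mx *m C + h^~mx) *m z) <= 1 <-> C *m z <=mx r /\ z <=mx h.
Proof.
move=> r_reg h_reg; rewrite mulmxDl scalD tleD_lub -mulmxA.
by rewrite -(conj_mul_leP (C *m z) r_reg) -(conj_mul_leP z h_reg);
  split=> [/andP|[-> ->]].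
Qed.

(** Substituting one inequality into the other eliminates [y]. *)
Lemma coupled_subfixed m n (C : 'M[X]_(m, n)) (D : 'M[X]_(n, m)) q r g h x y :
  coupled C D q r g h x y -> D *m C *m x <=mx x.
Proof.
move=> [_ _ [/lemxD_lub[Cx _] _] [/lemxD_lub[Dy _] _]].
by rewrite -mulmxA; apply: lemx_trans Dy; apply: lemx_mul2l.
Qed.

Lemma coupled_row_le1 m n (C : 'M[X]_(m, n)) (D : 'M[X]_(n, m)) q r g h x y k :
  regular r -> regular h -> coupled C D q r g h x y ->
  scal ((r^~mx *m C + h^~mx) *m (D *m C) ^+ k *m g) <= 1.
Proof.
move=> r_reg h_reg xy; have := coupled_subfixed xy.
case: xy => _ _ [/lemxD_lub[Cx _] yr] [/lemxD_lub[_ gx] xh] Sx.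
have Sgx : (D *m C) ^+ k *m g <=mx x.
  by apply: lemx_trans (power_subfixed k Sx); apply: lemx_mul2l.
rewrite -mulmxA; apply/residual_row_leP => //; split; last exact: lemx_trans xh.
by apply: lemx_trans yr; apply: lemx_trans Cx; apply: lemx_mul2l.
Qed.

Lemma coupled_solvable_of m n (C : 'M[X]_(m, n)) (D : 'M[X]_(n, m)) q r g h x y :
  regular r -> regular h -> coupled C D q r g h x y ->
  coupled_solvable C D q r g h.
Proof.
move=> r_reg h_reg xy; have yx := coupledC xy; split=> [|k|k].
- apply: circuits_le1_subfixed (coupled_subfixed yx); by case: yx.
- exact: coupled_row_le1 yx.
- exact: coupled_row_le1 xy.
Qed.

Lemma residual_star_neq0 m n (C : 'M[X]_(m, n)) (M : 'M[X]_n) (r : 'cV[X]_m)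
    (h : 'cV[X]_n) :
  regular h -> circuits_le1 M ->
  forall j, ((r^~mx *m C + h^~mx) *m kstar M) ord0 j != 0.
Proof.
move=> h_reg M_le1 j.
have: h^~mx *m 1%:M <=mx (r^~mx *m C + h^~mx) *m kstar M.
  by apply: lemx_mul (id_le_kstar M_le1); apply: lemxDr.
rewrite mulmx1 => /(_ ord0 j)/tle_neq0; apply; exact: tconj_neq0.
Qed.

(** The upper bound on the parameter says exactly that its two images in the
    system respect [h] and [r]. *)
Lemma parameter_boundP m n (C : 'M[X]_(m, n)) (M : 'M[X]_n) (r : 'cV[X]_m)
    (h u : 'cV[X]_n) :
  regular r -> regular h -> circuits_le1 M ->
  u <=mx ((r^~mx *m C + h^~mx) *m kstar M)^~mx <->
  C *m (kstar M *m u) <=mx r /\ kstar M *m u <=mx h.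
Proof.
move=> r_reg h_reg M_le1; rewrite -row_mul_leP; last exact: residual_star_neq0.
by rewrite -mulmxA residual_row_leP.
Qed.

(** The half of the sufficiency proof that concerns [x]; the other half follows
    by exchanging the unknowns. The key identity is that [D] moves through the
    star, [kstar (D C) D = D kstar (C D)], after which the extra factor [D C] is
    absorbed by the star. *)
Lemma star_half_solution m n (C : 'M[X]_(m, n)) (D : 'M[X]_(n, m)) g h u v x y :
  circuits_le1 (C *m D) -> regular u -> g <=mx u ->
  kstar (D *m C) *m u <=mx h -> D *m (kstar (C *m D) *m v) <=mx h ->
  x = kstar (D *m C) *m (u + D *m v) ->
  y = kstar (C *m D) *m (C *m u + v) ->
  [/\ regular x, D *m y + g <=mx x & x <=mx h].
Proof.
move=> Q_le1 u_reg gu uh vh -> ->; have S_le1 := circuits_le1C Q_le1.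
have ux : u <=mx kstar (D *m C) *m (u + D *m v).
  rewrite -[X in X <=mx _]mul1mx.
  exact: lemx_mul (id_le_kstar S_le1) (lemxDl _ _).
split; first exact: lemx_regular ux u_reg.
  apply/lemxD_lub; split; last exact: lemx_trans ux.
  rewrite mulmxA -kstar_mulC // -mulmxA !mulmxDr; apply/lemxD_lub; split.
    apply: lemx_trans (lemxDl _ _); rewrite [D *m (C *m u)]mulmxA.
    exact: kstar_mul_le.
  exact: lemxDr.
by rewrite mulmxDr; apply/lemxD_lub; split; rewrite // mulmxA kstar_mulC // -mulmxA.
Qed.

(** Conversely to the half solutions, a solution is its own parameter: [x] and [y]
    are fixed by the stars, and [D y], [C x] are absorbed in [x], [y]. *)
Lemma coupled_solutionP m n (C : 'M[X]_(m, n)) (D : 'M[X]_(n, m)) q r g h x y :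
  regular r -> regular h -> circuits_le1 (C *m D) ->
  coupled C D q r g h x y <->
  exists (u : 'cV[X]_n) (v : 'cV[X]_m),
    [/\ regular u /\ regular v,
        g <=mx u /\ u <=mx ((h^~mx + r^~mx *m C) *m kstar (D *m C))^~mx,
        q <=mx v /\ v <=mx ((h^~mx *m D + r^~mx) *m kstar (C *m D))^~mx,
        x = kstar (D *m C) *m (u + D *m v) &
        y = kstar (C *m D) *m (C *m u + v)].
Proof.
move=> r_reg h_reg Q_le1; have S_le1 := circuits_le1C Q_le1.
split=> [xy | [u [v [[u_reg v_reg] [gu u_bnd] [qv v_bnd] def_x def_y]]]].
  have Sx := coupled_subfixed xy; have Qy := coupled_subfixed (coupledC xy).
  case: xy => x_reg y_reg [/lemxD_lub[Cx qy] yr] [/lemxD_lub[Dy gx] xh].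
  exists x, y; split=> //.
  - split=> //; rewrite addrC; apply/parameter_boundP => //.
    rewrite kstar_fixed //; split=> //; exact: lemx_trans yr.
  - split=> //; apply/parameter_boundP => //.
    rewrite kstar_fixed //; split=> //; exact: lemx_trans xh.
  - by have /lemxE := Dy; rewrite addrC => ->; rewrite kstar_fixed.
  - by have /lemxE := Cx => ->; rewrite kstar_fixed.
rewrite addrC in u_bnd.
have [ur uh] := (parameter_boundP C u r_reg h_reg S_le1).1 u_bnd.
have [vh vr] := (parameter_boundP D v h_reg r_reg Q_le1).1 v_bnd.
have [x_reg Dy xh] := star_half_solution Q_le1 u_reg gu uh vh def_x def_y.
have [y_reg Cx yr] : [/\ regular y, C *m x + q <=mx y & y <=mx r].
  by apply: (star_half_solution S_le1 v_reg qv vr ur); rewrite addrC.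
by split.
Qed.

Lemma coupled_solvableP m n (C : 'M[X]_(m, n)) (D : 'M[X]_(n, m)) q r g h :
  regular r -> regular h ->
  (exists x y, coupled C D q r g h x y) <-> coupled_solvable C D q r g h.
Proof.
move=> r_reg h_reg; split=> [[x [y]]|[Q_le1 Hq Hg]].
  exact: coupled_solvable_of.
have S_le1 := circuits_le1C Q_le1.
have u_row := residual_star_neq0 C r h_reg S_le1.
have v_row := residual_star_neq0 D h r_reg Q_le1.
(* the largest admissible parameters *)
pose u := ((r^~mx *m C + h^~mx) *m kstar (D *m C))^~mx.
pose v := ((h^~mx *m D + r^~mx) *m kstar (C *m D))^~mx.
exists (kstar (D *m C) *m (u + D *m v)), (kstar (C *m D) *m (C *m u + v)).
apply/coupled_solutionP => //; exists u, v; split=> //.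
- by split=> i; apply: tconj_neq0.
- rewrite [h^~mx + _]addrC; split=> //.
  by apply/row_mul_leP => //; apply/row_kstar_leP.
- by split=> //; apply/row_mul_leP => //; apply/row_kstar_leP.
Qed.

(** The empty power is harmless in the trace condition, since the trace of the
    identity is at most 1. *)
Lemma coupled_solvable_min m n (C : 'M[X]_(m, n)) (D : 'M[X]_(n, m)) q r g h
    (l := minn m n) :
  coupled_solvable C D q r g h <->
  [/\ forall k, (k <= l)%N -> \tr ((C *m D) ^+ k) <= 1,
      forall k, (k <= l)%N ->
        scal ((h^~mx *m D + r^~mx) *m (C *m D) ^+ k *m q) <= 1 &
      forall k, (k <= l)%N ->
        scal ((r^~mx *m C + h^~mx) *m (D *m C) ^+ k *m g) <= 1].
Proof.
split=> [[H1 H2 H3] | [H1 H2 H3]].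
  split=> [[|k] _ |k _|k _] //; last exact: H1.
  by apply/tle_bigsumP => i _; rewrite expr0 mxE eqxx.
have Q_le1 : circuits_le1 (C *m D).
  by apply: circuits_le1_min => k /andP[_ kl]; apply: H1.
split=> //; apply: row_power_le_min => //; last by rewrite minnC.
exact: circuits_le1C.
Qed.

End Coupled.

(** * Expanding powers of a sum into words *)

Section Words.

Variable X : tropSemifieldType.

(** Words with exponents in [nat]: unlike bounded exponents, these can be
    increased or shifted without changing their type. *)
Definition word_at N (R S : 'M[X]_N) k (i : 'I_k.+1 -> nat) : 'M[X]_N :=
  S ^+ i ord0 * \prod_(j < k) (R * S ^+ i (lift ord0 j)).

Lemma wordsum_leP N (R S : 'M[X]_N) b k (F : 'M[X]_N -> X) c :
  wordsum R S b k F <= c <->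
  forall i : 'I_k.+1 -> nat, (\sum_j i j <= b)%N -> F (word_at R S i) <= c.
Proof.
split=> [/tle_bigsumP H i ib | H]; last first.
  by apply/tle_bigsumP => i ib; apply: (H (fun j => i j : nat)).
pose f : {ffun 'I_k.+1 -> 'I_b.+1} := [ffun j => inord (i j)].
have fE j : f j = i j :> nat.
  rewrite ffunE inordK // ltnS; apply: leq_trans ib.
  by rewrite (bigD1 j) //= leq_addr.
have -> : word_at R S i = word R S f.
  by rewrite /word fE; congr (_ * _); apply: eq_bigr => j _; rewrite fE.
by apply: H; under eq_bigr do rewrite fE.
Qed.

Lemma word_at_le N (P Q : 'M[X]_N) t k (i : 'I_k.+1 -> nat) :
  t ^+ k *: word_at P Q i <=mx (t *: P + Q) ^+ (k + \sum_j i j).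
Proof.
set M := t *: P + Q.
have QM e : Q ^+ e <=mx M ^+ e by apply/lemx_exp/lemxDr.
have tail_le (f : 'I_k -> nat) :
    t ^+ k *: \prod_(j < k) (P * Q ^+ f j) <=mx M ^+ (k + \sum_j f j).
  elim: k f {i} => [|k IH] f; first by rewrite !big_ord0 expr0 scale1r addn0.
  rewrite !big_ord_recl exprS addSn addnCA exprS exprD mulrA -scalerA.
  rewrite -!mulmxE scalemxAr !scalemxAl.
  apply: lemx_mul (IH (fun j => f (lift ord0 j))).
  by apply: lemx_mul => //; apply: lemxDl.
rewrite big_ord_recl addnCA exprD -!mulmxE scalemxAr.
exact: lemx_mul (QM _) (tail_le (fun j => i (lift ord0 j))).
Qed.

(** Expansion of a power over words. The expansion is phrased for an arbitrary
    predicate closed under sums, since in the induction the first letter is moved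
    into the predicate; this also avoids a sum over index sets of varying
    type. *)
Lemma power_word_ind N (P Q : 'M[X]_N) t L (G : 'M[X]_N -> Prop) :
  (forall A B, G A -> G B -> G (A + B)) ->
  (forall k (i : 'I_k.+1 -> nat), (k + \sum_j i j)%N = L ->
     G (t ^+ k *: word_at P Q i)) ->
  G ((t *: P + Q) ^+ L).
Proof.
elim: L G => [|L IH] G GD Gword.
  have := Gword 0%N (fun=> 0%N).
  by rewrite /word_at big_ord_recl !big_ord0 !expr0 scale1r mulr1; apply.
rewrite exprS mulrDl; apply: (GD).
  apply: (IH (fun A => G (t *: P * A))) => [A B GA GB | k i kiL].
    by rewrite mulrDr; apply: GD.
  (* a letter P in front opens a new block with exponent 0 *)
  pose i' (j : 'I_k.+2) := oapp i 0%N (unlift ord0 j).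
  have i'0 : i' ord0 = 0%N by rewrite /i' unlift_none.
  have i'S j : i' (lift ord0 j) = i j by rewrite /i' liftK.
  clearbody i'.
  have -> : t *: P * (t ^+ k *: word_at P Q i) = t ^+ k.+1 *: word_at P Q i'.
    rewrite /word_at i'0 expr0 mul1r [in RHS]big_ord_recl i'S exprS -scalerA.
    under [in RHS]eq_bigr => j _ do rewrite i'S.
    by rewrite -!mulmxE -scalemxAl -scalemxAr -mulmxA.
  apply: Gword; rewrite -kiL big_ord_recl i'0 add0n addSn.
  by congr (_ + _).+1; apply: eq_bigr => j _; apply: i'S.
apply: (IH (fun A => G (Q * A))) => [A B GA GB | k i kiL].
  by rewrite mulrDr; apply: GD.
(* a letter Q in front lengthens the first block *)
pose i' (j : 'I_k.+1) := (i j + (j == ord0))%N.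
have i'0 : i' ord0 = (i ord0).+1 by rewrite /i' eqxx addn1.
have i'S j : i' (lift ord0 j) = i (lift ord0 j) by rewrite /i' addn0.
clearbody i'; have -> : Q * (t ^+ k *: word_at P Q i) = t ^+ k *: word_at P Q i'.
  rewrite /word_at i'0 exprS; under [in RHS]eq_bigr => j _ do rewrite i'S.
  by rewrite -!mulmxE -scalemxAr -!mulmxA.
apply: Gword; rewrite -kiL !big_ord_recl i'0 addSn addnS.
by congr (_ + (_ + _)).+1; apply: eq_bigr => j _; apply: i'S.
Qed.

(** [phi] is meant to be the trace or the sandwich between a row and a column;
    for such functionals the powers and the words carry the same bounds. *)
Lemma words_leP N (P Q : 'M[X]_N) (phi : 'M[X]_N -> X) th c l :
  (forall A B, phi (A + B) = phi A + phi B) ->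
  (forall a A, phi (a *: A) = a * phi A) -> th != 0 ->
  (forall L, (L <= l)%N -> phi ((tinv th *: P + Q) ^+ L) <= c) <->
  (forall k (i : 'I_k.+1 -> nat), (k + \sum_j i j <= l)%N ->
     phi (word_at P Q i) <= c * th ^+ k).
Proof.
move=> phiD phiZ th0; split=> [H k i kil | H L Ll].
  rewrite -tle_div_exp // -phiZ; apply: le_trans (H _ kil).
  by rewrite tleE -phiD (lemxE _ _).1 //; apply: word_at_le.
apply: (@power_word_ind _ P Q _ L (fun A => phi A <= c)) => [A B GA GB | k i kiL].
  by rewrite phiD tleD_lub GA GB.
by rewrite phiZ tle_div_exp //; apply: H; rewrite kiL.
Qed.

(** Words without the letter [P] are the powers of [Q]; they carry no factor
    depending on [th], so they have to be bounded beforehand. *)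
Lemma root_words_leP N (P Q : 'M[X]_N) (phi : 'M[X]_N -> X) th l :
  (forall A B, phi (A + B) = phi A + phi B) ->
  (forall a A, phi (a *: A) = a * phi A) -> th != 0 ->
  (forall L, (L <= l)%N -> phi (Q ^+ L) <= 1) ->
  \sum_(1 <= k < l.+1) wordsum P Q (l - k) k (fun W => troot k (phi W)) <= th
  <-> forall L, (L <= l)%N -> phi ((tinv th *: P + Q) ^+ L) <= 1.
Proof.
move=> phiD phiZ th0 Q_le1; rewrite words_leP //; split=> [/tle_natsumP H | H].
  move=> [|k] i kil.
    rewrite /word_at big_ord0 !mulr1; apply: Q_le1.
    by move: kil; rewrite big_ord_recl; lia.
  have /H/wordsum_leP/(_ i) : (1 <= k.+1 < l.+1)%N by lia.
  by rewrite troot_leP // mul1r; apply; lia.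
apply/tle_natsumP => k kl; apply/wordsum_leP => i il.
by rewrite troot_leP; [rewrite -[_ ^+ _]mul1r; apply: H|]; lia.
Qed.

(** Here the functional itself carries one more letter [A], so that the bound [th]
    replaces 1, roots are one degree higher, and words without [P] are covered
    as well. *)
Lemma root_words_succ_leP N (P Q : 'M[X]_N) (phi : 'M[X]_N -> X) th l :
  (forall A B, phi (A + B) = phi A + phi B) ->
  (forall a A, phi (a *: A) = a * phi A) -> th != 0 ->
  \sum_(0 <= k < l.+1) wordsum P Q (l - k) k (fun W => troot k.+1 (phi W)) <= th
  <-> forall L, (L <= l)%N -> phi ((tinv th *: P + Q) ^+ L) <= th.
Proof.
move=> phiD phiZ th0; rewrite words_leP //; split=> [/tle_natsumP H k i kil | H].
  have /H/wordsum_leP/(_ i) : (0 <= k < l.+1)%N by lia.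
  by rewrite troot_leP // exprS; apply; lia.
apply/tle_natsumP => k kl; apply/wordsum_leP => i il.
by rewrite troot_leP // exprS; apply: H; lia.
Qed.

End Words.

(** * The optimal value *)

Section Value.

Variable X : tropSemifieldType.

(** The four sums that make up the value correspond to the circuits, to the bound
    for [q], and to the two parts into which the bound for [g] splits: its row
    contains [r^- (th^-1 A + C)], whose [A]-part gives the fourth sum. *)
Lemma eta_leP m n (A C : 'M[X]_(m, n)) (D : 'M[X]_(n, m)) q r g h th :
  coupled_solvable C D q r g h -> th != 0 ->
  eta_value A C D q r g h <= th <->
  coupled_solvable (tinv th *: A + C) D q r g h.
Proof.
move=> /coupled_solvable_min [HQ Hq Hg] th0; rewrite coupled_solvable_min.
rewrite (mulmxDl _ _ D) (mulmxDr D) -scalemxAl -(scalemxAr _ D).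
have rowD N (a : 'rV[X]_N) (b : 'cV[X]_N) U V :
    scal (a *m (U + V) *m b) = scal (a *m U *m b) + scal (a *m V *m b).
  by rewrite mulmxDr mulmxDl scalD.
have rowZ N (a : 'rV[X]_N) (b : 'cV[X]_N) t U :
    scal (a *m (t *: U) *m b) = t * scal (a *m U *m b).
  by rewrite -scalemxAr -scalemxAl scalZ.
have trE := root_words_leP (A *m D) (@mxtraceD _ m) (@mxtraceZ _ m) th0 HQ.
have qE := root_words_leP (A *m D) (rowD _ _ _) (rowZ _ _ _) th0 Hq.
have gE := root_words_leP (D *m A) (rowD _ _ _) (rowZ _ _ _) th0 Hg.
have rE := root_words_succ_leP (D *m A) (D *m C) (minn m n)
  (rowD _ (r^~mx *m A) g) (rowZ _ (r^~mx *m A) g) th0.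
have splitE k : scal ((r^~mx *m (tinv th *: A + C) + h^~mx)
      *m (tinv th *: (D *m A) + D *m C) ^+ k *m g) <= 1 <->
    scal (r^~mx *m A *m (tinv th *: (D *m A) + D *m C) ^+ k *m g) <= th /\
    scal ((r^~mx *m C + h^~mx)
      *m (tinv th *: (D *m A) + D *m C) ^+ k *m g) <= 1.
  rewrite mulmxDr -addrA (mulmxDl (r^~mx *m (tinv th *: A))).
  rewrite [X in scal X]mulmxDl scalD tleD_lub.
  by rewrite -scalemxAr -!scalemxAl scalZ tle_divl // mulr1; split=> /andP.
rewrite /eta_value !tleD_lub; split.
  move=> /andP[/andP[/andP[/trE ? /gE H1] /qE ?] /rE H2]; split=> // k kl.
  by apply/splitE; split; [apply: H2 | apply: H1].
move=> [H1 H2 H3]; rewrite -!andbA; apply/and4P; split.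
- exact/trE.
- by apply/gE => k /H3/splitE[].
- exact/qE.
- by apply/rE => k /H3/splitE[].
Qed.

Lemma coupled_objectiveP m n (A C : 'M[X]_(m, n)) (D : 'M[X]_(n, m)) q r g h
    th x y : th != 0 ->
  coupled (tinv th *: A + C) D q r g h x y <->
  coupled C D q r g h x y /\ objective A x y <= th.
Proof.
move=> th0; split.
  move=> [x_reg y_reg [/lemxD_lub[Cx qy] yr] Hx].
  move: Cx; rewrite mulmxDl => /lemxD_lub[Ax Cx]; split.
    by split=> //; split=> //; apply/lemxD_lub.
  exact/objective_leP.
move=> [[x_reg y_reg [/lemxD_lub[Cx qy] yr] Hx] /(objective_leP A x y_reg th0) Ax].
by split=> //; split=> //; apply/lemxD_lub; rewrite mulmxDl; split=> //;
  apply/lemxD_lub.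
Qed.

Lemma feasible_coupledP m n (B C D : 'M[X]_(m, n)) q r g h mu x y :
  feasible B C D q r g h mu x y <->
  coupled (tinv mu *: C) (B^~mx + D^~mx) q r g h x y.
Proof.
split=> [[x_reg y_reg By Hy [/lemxD_lub[Dy gx] xh]] |
         [x_reg y_reg Hy [/lemxD_lub[Dy gx] xh]]].
  by split=> //; split=> //; apply/lemxD_lub; rewrite mulmxDl; split=> //;
    apply/lemxD_lub.
move: Dy; rewrite mulmxDl => /lemxD_lub[By Dy]; split=> //; split=> //.
exact/lemxD_lub.
Qed.

(** The Boolean semifield has no such scalar; otherwise one of [a] and its inverse
    is below 1. *)
Lemma exists_lt1 : (exists a : X, a != 0 /\ a != 1) ->
  exists b : X, b != 0 /\ b < 1.
Proof.
move=> [a [a0 a1]]; have [a_lt1 | a_ge1] := ltP a 1; first by exists a.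
exists (tinv a); split; first exact: tinv_neq0.
have Va_le1 : tinv a <= 1 by rewrite -[tinv a]mulr1 tle_divl // mulr1.
rewrite lt_neqAle Va_le1 andbT.
by apply: contra a1 => /eqP Va1; rewrite -(tmulxV a0) Va1 mulr1.
Qed.

End Value.

Theorem theorem11 (X : tropSemifieldType) (m n : nat)
    (A B C D : 'M[X]_(m, n)) (q r : 'cV[X]_m) (g h : 'cV[X]_n)
    (C_nonzero : C != 0)
    (mu_gt0 : (0 : X) < mu_value C D q r g h)
    (h_regular : regular h) (r_regular : regular r) (A_nonzero : A != 0) :
  let mu := mu_value C D q r g h in
  let D1 := B^~mx + D^~mx in
  let C1 := tinv mu *: C in
  let P := A *m D1 in
  let Q := C1 *m D1 in
  let R := D1 *m A in
  let S := D1 *m C1 in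
  let eta := eta_value A C1 D1 q r g h in
  let condition :=
    Trc Q + scal ((h^~mx *m D1 + r^~mx) *m kstar Q *m q)
          + scal ((r^~mx *m C1 + h^~mx) *m kstar S *m g) <= 1 in
  ((exists x y, feasible B C D q r g h mu x y) <-> condition) /\
  (condition ->
   (forall x y, feasible B C D q r g h mu x y ->
      (0 : X) < objective A x y /\ eta <= objective A x y) /\
   ((0 : X) < eta \/
      (exists a : X, a != 0 /\ a != 1) /\
      (exists x y, optimal A B C D q r g h mu x y) ->
    [/\ (0 : X) < eta,
        optimal_value A B C D q r g h mu eta &
        forall (x : 'cV[X]_n) (y : 'cV[X]_m),
          optimal A B C D q r g h mu x y <->
          exists (u : 'cV[X]_n) (v : 'cV[X]_m),
            [/\ regular u /\ regular v,
                g <=mx u /\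
                u <=mx ((h^~mx + r^~mx *m (tinv eta *: A + C1))
                          *m kstar (tinv eta *: R + S))^~mx,
                q <=mx v /\
                v <=mx ((h^~mx *m D1 + r^~mx)
                          *m kstar (tinv eta *: P + Q))^~mx,
                x = kstar (tinv eta *: R + S) *m (u + D1 *m v) &
                y = kstar (tinv eta *: P + Q)
                      *m ((tinv eta *: A + C1) *m u + v)]])).
Proof.
move=> mu D1 C1 P Q R S eta condition.
have condE : condition <-> coupled_solvable C1 D1 q r g h.
  exact: coupled_solvable_starP.
have feasE x y : feasible B C D q r g h mu x y <-> coupled C1 D1 q r g h x y.
  exact: feasible_coupledP.
have below (th : X) x y : th != 0 ->
    coupled (tinv th *: A + C1) D1 q r g h x y <->
    feasible B C D q r g h mu x y /\ objective A x y <= th.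
  by move=> th0; rewrite coupled_objectiveP // feasE.
split.
  rewrite condE -coupled_solvableP //.
  by split=> -[x [y xy]]; exists x, y; apply/feasE.
move=> /condE solv.
have obj_neq0 x y : feasible B C D q r g h mu x y -> objective A x y != 0.
  by case=> x_reg y_reg _ _ _; apply: objective_neq0.
have eta_lb x y : feasible B C D q r g h mu x y -> eta <= objective A x y.
  move=> xy; have th0 := obj_neq0 x y xy; apply/eta_leP => //.
  by apply/coupled_solvableP => //; exists x, y; apply/below.
have reach (th : X) : th != 0 -> eta <= th ->
    exists x y, feasible B C D q r g h mu x y /\ objective A x y <= th.
  move=> th0 /(eta_leP _ solv th0)/(coupled_solvableP _ _ _ _ r_regular h_regular).
  by move=> [x [y /(below _ _ _ th0)[xy obj]]]; exists x, y.
split=> [x y xy | eta_or]; first by rewrite tlt0x obj_neq0 ?eta_lb.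
have eta0 : eta != 0.
  case: eta_or => [|[/exists_lt1[b [b0 b1]] [x [y [xy opt]]]]].
    by rewrite tlt0x.
  apply/eqP => eta0; have th0 := obj_neq0 x y xy.
  (* were eta zero, the optimum could be improved by the factor b *)
  have [|x' [y' [xy' obj']]] := reach (b * objective A x y) (tmul_neq0 b0 th0).
    by rewrite eta0 tle0x.
  have /negP[] : ~~ ((1 : X) <= b) by rewrite -ltNge.
  rewrite -(tle_pmul2l _ _ th0) mulr1 mulrC.
  exact: le_trans (opt _ _ xy') obj'.
have optE x y : optimal A B C D q r g h mu x y <->
    coupled (tinv eta *: A + C1) D1 q r g h x y.
  rewrite below //; split=> [[xy opt] | [xy obj_eta]]; split=> //.
    have [x' [y' [xy' obj']]] := reach eta eta0 (lexx _).
    exact: le_trans (opt _ _ xy') obj'.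
  by move=> x' y' /eta_lb; apply: le_trans.
split; first by rewrite tlt0x.
  have [x [y [xy obj_eta]]] := reach eta eta0 (lexx _).
  exists x, y; split; first by apply/optE; apply/below.
  by apply/le_anti; rewrite obj_eta eta_lb.
have [eta_le1 _ _] := (eta_leP A solv eta0).1 (lexx eta).
move=> x y; rewrite optE coupled_solutionP //.
by rewrite (mulmxDl _ _ D1) (mulmxDr D1) -scalemxAl -(scalemxAr _ D1).
Qed.
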